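(* Let $H>0$. The set of all positive solutions of the nonlinear nonlocal boundary value problem \[\varphi'-(\varphi')^2+\varphi\varphi''+\frac{2}{H}\int_0^H(\varphi'(t))^2\,dt=0,\qquad \varphi(0)=\varphi(H)=0,\] is \[\left\{\varphi:\ \varphi=2\sqrt{m^2+\tfrac14}\;u_m,\ m>0\right\},\] where, for $m>0$, \[r=r(m):=\left(\frac12+\frac{1}{4\sqrt{m^2+1/4}}\right)^{-1}\in(1,2)\] and $u_m$ is the function \[u_m(x)=\frac{2H}{r\,\pi_{r,r}}\cos_{r,r}^{r-1}\left(\frac{\pi_{r,r}}{2H}x\right)\sin_{r,r}\left(\frac{\pi_{r,r}}{2H}x\right),\qquad x\in[0,H],\] which is the positive solution of $(p-q)u'-pq(u')^2+(p+q)u\,u''+1=0$, $u(0)=u(H)=0$, with $q=r$ and $p=r/(r-1)$.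
   Context: Generalized trigonometric functions: for $p,q\in(1,\infty)$, $\sin_{p,q}$ is the inverse function of $\sin_{p,q}^{-1}x:=\int_0^x \frac{dt}{(1-t^q)^{1/p}}$, $0\le x\le 1$, and $\pi_{p,q}:=2\sin_{p,q}^{-1}1=2\int_0^1\frac{dt}{(1-t^q)^{1/p}}$. Thus $\sin_{p,q}$ is increasing from $[0,\pi_{p,q}/2]$ onto $[0,1]$. One sets $\cos_{p,q}x:=(\sin_{p,q}x)'$, which satisfies $\cos_{p,q}^p x+\sin_{p,q}^q x=1$ with $\cos_{p,q}x\ge 0$ on $[0,\pi_{p,q}/2]$ (values at the endpoints are understood through this identity). Powers are written $\cos_{p,q}^a x=(\cos_{p,q}x)^a$. A positive solution is a function in $C([0,H])\cap C^2((0,H))$ that is $>0$ on $(0,H)$, satisfies the equation on $(0,H)$ (for the nonlocal problem, with $\int_0^H(\varphi')^2\,dt<\infty$) and satisfies the boundary conditions. *)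

(* Defs.v *)
From mathcomp Require Import all_boot all_order all_algebra.
From mathcomp Require Import all_classical all_reals all_analysis.
Set Implicit Arguments.
Unset Strict Implicit.
Unset Printing Implicit Defensive.

Import Order.TTheory GRing.Theory Num.Theory.
Import numFieldNormedType.Exports.

Local Open Scope classical_set_scope.
Local Open Scope ring_scope.

(* The generalized trigonometric functions are meant for 1 < p and 1 < q.
   Integrals are Lebesgue integrals; for these nonnegative integrands they
   coincide with the improper Riemann integrals.  The integrand of arcsin_pq
   is given the harmless value 0 at its singularity t = 1. *)
Definition arcsin_pq (R : realType) (p q x : R) : R :=
  (\int[lebesgue_measure]_(t in `[0, x]) ((1 - t `^ q) `^ p^-1)^-1)%R.

Definition pi_pq (R : realType) (p q : R) : R := 2 * arcsin_pq p q 1.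

(* Inverse of arcsin_pq on [0, 1]; only meaningful on [0, pi_pq p q / 2]. *)
Definition sin_pq (R : realType) (p q : R) : R -> R :=
  'pinv_(fun=> 0) `[0, 1] (arcsin_pq p q).

(* The derivative of sin_pq inside the interval; at its endpoints, where only
   a one-sided derivative makes sense, the value >= 0 that is forced by
   cos_pq ^ p + sin_pq ^ q = 1. *)
Definition cos_pq (R : realType) (p q x : R) : R :=
  if 0 < x < pi_pq p q / 2 then (sin_pq p q)^`()%classic x
  else (1 - sin_pq p q x `^ q) `^ p^-1.

(* A function on [0, H] is represented by any extension of it to R: the
   conditions below only depend on the values on [0, H], since derivatives
   are only taken at interior points. *)
Definition C0_C2 (R : realType) (H : R) (f : R -> R) : Prop :=
  [/\ {within `[0, H], continuous f},
      {in `]0, H[, forall x, derivable f x 1},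
      {in `]0, H[, forall x, derivable f^`()%classic x 1} &
      {in `]0, H[, continuous f^`(2)%classic}].

Definition positive_dirichlet (R : realType) (H : R) (f : R -> R) : Prop :=
  [/\ C0_C2 H f, {in `]0, H[, forall x, 0 < f x}, f 0 = 0 & f H = 0].

Definition local_positive_solution (R : realType) (p q H : R) (u : R -> R) :
    Prop :=
  positive_dirichlet H u /\
  {in `]0, H[, forall x,
    (p - q) * u^`()%classic x - p * q * u^`()%classic x ^+ 2
      + (p + q) * u x * u^`(2)%classic x + 1 = 0}.

Definition nonlocal_positive_solution (R : realType) (H : R) (phi : R -> R) :
    Prop :=
  [/\ positive_dirichlet H phi,
      (\int[lebesgue_measure]_(t in `]0%R, H[) (phi^`()%classic t ^+ 2)%:E
         < +oo)%E &
      {in `]0, H[, forall x,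
        phi^`()%classic x - phi^`()%classic x ^+ 2 + phi x * phi^`(2)%classic x
          + 2 / H *
              (\int[lebesgue_measure]_(t in `]0, H[) phi^`()%classic t ^+ 2)%R
          = 0}].

Definition r_of (R : realType) (m : R) : R :=
  (1 / 2 + 1 / (4 * Num.sqrt (m ^+ 2 + 1 / 4)))^-1.

Definition u_of (R : realType) (H m x : R) : R :=
  let r := r_of m in
  let k := pi_pq r r / (2 * H) in
  2 * H / (r * pi_pq r r) * cos_pq r r (k * x) `^ (r - 1) * sin_pq r r (k * x).

(* Main.v *)
Require Import Defs.
From mathcomp Require Import all_boot all_order all_algebra.
From mathcomp Require Import all_classical all_reals all_analysis.
From mathcomp Require Import measurable_realfun ring lra.

(** Both equations are [f f'' = (f' - c / r) (f' - (c / r - c))], with [c = 1]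
    for the local problem and [c = 2 sqrt (m ^ 2 + 1 / 4)] for the nonlocal one,
    [m ^ 2] being the value of the integral term. Each factor [f' - root] solves
    a linear equation, so by Rolle's theorem [f'] stays strictly between the two
    roots. Hence [s := (1 / r - f' / c) ^ (1 / r)] lies in (0, 1), the quantity
    [s (1 - s ^ r) ^ (1 - 1 / r) / f] is constant, and [arcsin_pq r r s] is affine;
    the boundary values determine this affine function. In the nonlocal problem
    the value of the integral term is automatic: integrate
    [(f f')' = 2 f' ^ 2 - f' - m ^ 2] over [[0, H]]. *)

Set Implicit Arguments.
Unset Strict Implicit.
Unset Printing Implicit Defensive.

Import Order.TTheory GRing.Theory Num.Theory.
Import numFieldNormedType.Exports.

Local Open Scope classical_set_scope.
Local Open Scope ring_scope.

(** * Integrability of a singular power at the right end of the unit interval *)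

Section singular_power.
Context {R : realType}.
Local Notation mu := (@lebesgue_measure R).

Lemma is_derive_powR_onem (a x : R) : x < 1 ->
  is_derive x 1 (fun t => (1 - t) `^ a) (- (a * (1 - x) `^ (a - 1))).
Proof.
move=> x1; have x0 : 0 < 1 - x by rewrite subr_gt0.
have h := is_derive1_powR a x0.
have g : is_derive x 1 (fun t : R => 1 - t) (-1 : R).
  by apply: is_derive_eq; rewrite add0r mul1r.
by have := @is_derive1_comp R _ _ x _ _ h g; rewrite mulrN1.
Qed.

(** The primitive [G] bounds the integrals over segments ending before the singularity by
    [1 / (1 - a)], uniformly. Monotone convergence along an exhaustion of [[0, 1[] keeps the bound,
    and the point 1 is negligible. *)
Lemma integrable_powR_onem (a : R) : 0 < a < 1 ->
  mu.-integrable `[0, 1] (EFin \o (fun t => (1 - t) `^ (- a))).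
Proof.
move=> /andP[a0 a1].
have b0 : 0 < 1 - a by rewrite subr_gt0.
pose g (t : R) := (1 - t) `^ (- a).
pose G (t : R) := - ((1 - t) `^ (1 - a) / (1 - a)).
have mg : measurable_fun [set: R] g.
  apply: (measurableT_comp (measurable_powR (- a))).
  exact: measurable_funB.
have dG (x : R) : x < 1 -> is_derive x 1 G (g x).
  move=> x1; have := is_derive_powR_onem (1 - a) x1 => h.
  have : is_derive x 1 (fun t => - ((1 - t) `^ (1 - a) / (1 - a)))
     (- ((- ((1 - a) * (1 - x) `^ (1 - a - 1))) / (1 - a))).
    have -> : (fun t : R => - ((1 - t) `^ (1 - a) / (1 - a))) =
      (- (1 - a)^-1) \*: (fun t => (1 - t) `^ (1 - a)).
      by apply/funext => t; rewrite /= /GRing.scale/= mulNr mulrC.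
    apply: is_derive_eq; rewrite /GRing.scale/=; ring.
  rewrite /G /g; congr is_derive.
  rewrite (_ : 1 - a - 1 = - a); last by ring.
  by field; rewrite gt_eqF.
have cg : {in `]-oo, 1[, continuous g}.
  move=> x; rewrite in_itv/= => x1; apply: differentiable_continuous.
  by apply/derivable1_diffP; apply: ex_derive; exact: is_derive_powR_onem.
(* The index is shifted to [n + 2] so that every segment has positive length, as the fundamental
   theorem of calculus requires. *)
pose F (n : nat) : set R := `[0, 1 - n.+2%:R^-1]%classic.
have F1 n : (1 - n.+2%:R^-1 : R) < 1 by rewrite ltrBlDr ltrDl invr_gt0.
have F0 n : (0 : R) < 1 - n.+2%:R^-1.
  by rewrite subr_gt0 invf_lt1// ltr1n.
have FE : \bigcup_n F n = `[0%R, 1%R[%classic.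
  apply/seteqP; split => x.
    move=> [n _]; rewrite /F/= !in_itv/= => /andP[-> /= h].
    exact: le_lt_trans h (F1 n).
  rewrite /= in_itv/= => /andP[x0 x1].
  have [n nx] : exists n : nat, (1 - x)^-1 < n.+2%:R.
    have := archi_boundP (ltW (_ : 0 < (1 - x)^-1)).
    rewrite invr_gt0 subr_gt0 => /(_ x1) h.
    exists (Num.bound (1 - x)^-1); apply: lt_trans h _.
    by rewrite ltr_nat.
  exists n => //; rewrite /F/= in_itv/= x0/=.
  rewrite lerBrDl -lerBrDr ltW//.
  by rewrite invf_plt ?posrE ?subr_gt0 ?ltr0n.
have IF n : (\int[mu]_(t in F n) (g t)%:E <= (1 - a)^-1%:E)%E.
  rewrite (@continuous_FTC2 _ g G); last first.
  - by move=> x; rewrite in_itv/= => /andP[_ xn]; rewrite derive1E;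
      apply: derive_val; exact: (dG _ (lt_trans xn (F1 n))).
  - split.
    + by move=> x; rewrite in_itv/= => /andP[_ xn]; apply: ex_derive;
        exact: (dG _ (lt_trans xn (F1 n))).
    + apply: cvg_at_right_filter; apply: differentiable_continuous.
      by apply/derivable1_diffP; apply: ex_derive; exact: dG.
    + apply: cvg_at_left_filter; apply: differentiable_continuous.
      by apply/derivable1_diffP; apply: ex_derive; exact: (dG _ (F1 n)).
  - apply: continuous_in_subspaceT => x; rewrite inE/= in_itv/= => /andP[_ xn].
    by apply: cg; rewrite in_itv/=; exact: le_lt_trans xn (F1 n).
  - exact: F0.
  rewrite -EFinB lee_fin /G subr0 powR1 opprK div1r.
  by rewrite gerDr oppr_le0 divr_ge0 ?powR_ge0// ltW.
apply/integrableP; split.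
  by apply/measurable_EFinP; exact: measurable_funTS.
apply: (@le_lt_trans _ _ (1 - a)^-1%:E); last exact: ltry.
under eq_integral => t _ do rewrite /= ger0_norm ?powR_ge0//.
rewrite -integral_itv_bndo_bndc; last first.
  by apply/measurable_EFinP; exact: measurable_funTS.
rewrite -FE.
have nF : nondecreasing_seq F.
  apply/nondecreasing_seqP => n; apply/subsetPset => x.
  rewrite /F/= !in_itv/= => /andP[-> /=] /le_trans; apply.
  by rewrite lerB// lef_pV2 ?posrE// ler_nat.
have mF i : measurable_fun (F i) (EFin \o g).
  by apply/measurable_EFinP; exact: measurable_funTS.
have g0 i x : F i x -> (0 <= (EFin \o g) x)%E.
  by move=> _; rewrite lee_fin powR_ge0.
have cF : (\int[mu]_(x in F i) (g x)%:E @[i --> \oo] -->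
    \int[mu]_(x in \bigcup_i F i) (g x)%:E)%E.
  by apply: ge0_nondecreasing_set_cvg_integral => // i; exact: measurable_itv.
rewrite -(cvg_lim _ cF)//; apply: lime_le; last by near=> n; exact: IF.
by apply/cvg_ex; exists (\int[mu]_(x in \bigcup_i F i) (g x)%:E)%E.
Unshelve. all: by end_near. Qed.

End singular_power.

(** * The generalized arcsine, its inverse, and their derivatives *)

Section arcsin_pq.
Context {R : realType} {p q : R}.
Hypotheses (p_gt1 : 1 < p) (q_gt1 : 1 < q).
Local Notation mu := (@lebesgue_measure R).
Local Notation arcsin := (arcsin_pq p q).
Local Notation sin := (sin_pq p q).
Local Notation h := (fun t : R => ((1 - t `^ q) `^ p^-1)^-1).

Let p_gt0 : 0 < p. Proof. exact: lt_trans p_gt1. Qed.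
Let q_gt0 : 0 < q. Proof. exact: lt_trans q_gt1. Qed.

Lemma powR_itvoo (a t : R) : 0 < a -> 0 < t < 1 -> 0 < t `^ a < 1.
Proof.
move=> a0 /andP[t0 t1]; rewrite powR_gt0//=.
have := @gt0_ltr_powR R _ a0 t 1; rewrite powR1; apply => //;
  by rewrite nnegrE ltW.
Qed.

Lemma powR_itvcc (a t : R) : 0 < a -> 0 <= t <= 1 -> 0 <= t `^ a <= 1.
Proof.
move=> a0 /andP[t0 t1]; rewrite powR_ge0//=.
have := @ge0_ler_powR R _ (ltW a0) t 1; rewrite powR1; apply => //.
by rewrite nnegrE.
Qed.

(** Since [q > 1] gives [t ^ q <= t] on the unit interval, the integrand is dominated by
    [(1 - t) ^ (- 1 / p)], whose exponent is integrable because [p > 1]. *)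
Lemma integrable_arcsin_pq : mu.-integrable `[0, 1] (EFin \o h).
Proof.
have mh : measurable_fun [set: R] h.
  have -> : h = (fun u => u `^ (- p^-1)) \o (fun t => 1 - t `^ q).
    by apply/funext => t /=; rewrite powRN.
  apply: (measurableT_comp (measurable_powR (- p^-1))).
  by apply: measurable_funB => //; exact: measurable_powR.
have p01 : 0 < p^-1 < 1 by rewrite invr_gt0 p_gt0 invf_lt1.
apply: le_integrable (integrable_powR_onem p01) => //.
  by apply/measurable_EFinP; exact: measurable_funTS.
move=> t; rewrite /= in_itv/= => /andP[t0 t1].
rewrite lee_fin !ger0_norm ?powR_ge0// ?invr_ge0 ?powR_ge0// powRN.
(* At the singularity both integrands reduce to the same default value. *)
have [->|tn1] := eqVneq t 1; first by rewrite powR1.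
have {tn1} t1' : t < 1 by rewrite lt_neqAle tn1.
have tq : t `^ q <= t.
  move: t0; rewrite le_eqVlt => /predU1P[<-|t0].
    by rewrite powR0// gt_eqF.
  by apply: ge1r_powR; [rewrite t0|exact: ltW].
have u0 : 0 < 1 - t by rewrite subr_gt0.
have uq : 1 - t <= 1 - t `^ q by rewrite lerD2l lerN2.
rewrite lef_pV2 ?posrE ?powR_gt0//; last exact: lt_le_trans uq.
apply: ge0_ler_powR => //; rewrite ?nnegrE ?invr_ge0 ?ltW//.
exact: lt_le_trans uq.
Qed.

Lemma continuous_arcsin_pq : {within `[0, 1], continuous arcsin}.
Proof. exact: parameterized_integral_continuous integrable_arcsin_pq. Qed.

Lemma is_derive_arcsin_pq (x : R) : 0 < x < 1 -> is_derive x 1 arcsin (h x).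
Proof.
move=> x01; have /andP[x0 x1] := x01.
have /andP[y0 y1] := powR_itvoo q_gt0 x01.
have ch : {for x, continuous h}.
  apply: differentiable_continuous; apply/derivable1_diffP.
  have d1 : derivable (fun t : R => 1 - t `^ q) x 1.
    by apply: derivableB => //; apply: derivable_powR; rewrite in_itv/= andbT.
  have -> : h = (fun u => u `^ (- p^-1)) \o (fun t => 1 - t `^ q).
    by apply/funext => t /=; rewrite powRN.
  apply/derivable1_diffP/differentiable_comp; first exact/derivable1_diffP.
  by apply/derivable1_diffP/derivable_powR; rewrite in_itv/= andbT subr_gt0.
have [d e] := continuous_FTC1_closed x1 integrable_arcsin_pq x0 ch.
by apply: DeriveDef => //; rewrite -derive1E.
Qed.

Lemma arcsin_pq0 : arcsin 0 = 0.
Proof. by rewrite /arcsin_pq set_itv1 Rintegral_set1. Qed.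

Lemma arcsin_pq_half : arcsin 1 = pi_pq p q / 2.
Proof. by rewrite /pi_pq mulrAC divff ?mul1r. Qed.

Lemma arcsin_pq_lt : {in `[0, 1] &, {homo arcsin : x y / x < y}}.
Proof.
apply: gtr0_derive1_lt_cc; last exact: continuous_arcsin_pq.
- by move=> x x01; apply: ex_derive; exact: is_derive_arcsin_pq.
- move=> x x01; rewrite derive1E (@derive_val _ _ _ _ _ _ _ (is_derive_arcsin_pq x01)).
  rewrite invr_gt0 powR_gt0// subr_gt0.
  by have /andP[] := powR_itvoo q_gt0 x01.
Qed.

Lemma arcsin_pq_inj : {in `[0, 1] &, injective arcsin}.
Proof.
move=> x y xI yI e; apply/eqP; case: ltgtP => // xy.
  by have := arcsin_pq_lt xI yI xy; rewrite e ltxx.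
by have := arcsin_pq_lt yI xI xy; rewrite e ltxx.
Qed.

Lemma pi_pq_gt0 : 0 < pi_pq p q.
Proof.
have := @arcsin_pq_lt 0 1; rewrite !in_itv/= !lexx ler01 => /(_ isT isT ltr01).
by rewrite arcsin_pq0 arcsin_pq_half; lra.
Qed.

Lemma arcsin_pqK : {in `[0, 1], cancel arcsin sin}.
Proof.
move=> x x01; rewrite /sin_pq.
apply: (@pinvKV _ _ (fun=> 0) `[0, 1]%classic arcsin); last by rewrite inE.
by move=> u v; rewrite !inE => uI vI; exact: arcsin_pq_inj.
Qed.

(** By the intermediate value theorem. It lets facts about [sin] be checked at points [arcsin x],
    where [arcsin_pqK] evaluates it. *)
Lemma arcsin_pq_surj (y : R) : 0 <= y <= pi_pq p q / 2 ->
  exists2 x, x \in `[0, 1] & arcsin x = y.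
Proof.
move=> yI; have := @IVT R arcsin 0 1 y ler01 continuous_arcsin_pq.
rewrite arcsin_pq0 arcsin_pq_half (min_idPl _) ?(max_idPr _); last 2 first.
- by rewrite divr_ge0 ?ltW ?pi_pq_gt0.
- by rewrite divr_ge0 ?ltW ?pi_pq_gt0.
exact.
Qed.

Lemma sin_pq_itvcc (y : R) : 0 <= y <= pi_pq p q / 2 -> 0 <= sin y <= 1.
Proof. by move=> /arcsin_pq_surj[x xI <-]; rewrite arcsin_pqK. Qed.

Lemma sin_pqK (y : R) : 0 <= y <= pi_pq p q / 2 -> arcsin (sin y) = y.
Proof. by move=> /arcsin_pq_surj[x xI <-]; rewrite arcsin_pqK. Qed.

Lemma sin_pq0 : sin 0 = 0.
Proof. by rewrite -{1}arcsin_pq0 arcsin_pqK// in_itv/= lexx ler01. Qed.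

Lemma sin_pq_half : sin (pi_pq p q / 2) = 1.
Proof. by rewrite -arcsin_pq_half arcsin_pqK// in_itv/= lexx ler01. Qed.

Lemma sin_pq_itvoo (y : R) : 0 < y < pi_pq p q / 2 -> 0 < sin y < 1.
Proof.
move=> /andP[y0 y1]; have yI : 0 <= y <= pi_pq p q / 2 by rewrite !ltW.
have /andP[s0 s1] := sin_pq_itvcc yI; have sK := sin_pqK yI.
rewrite !lt_neqAle s0 s1 !andbT; apply/andP; split; apply/eqP => e.
  by move: y0; rewrite -sK -e arcsin_pq0 ltxx.
by move: y1; rewrite -sK e arcsin_pq_half ltxx.
Qed.

Lemma continuous_sin_pq : {within `[0, pi_pq p q / 2], continuous sin}.
Proof.
rewrite -arcsin_pq0 -arcsin_pq_half.
apply: segment_can_le_continuous => //; first exact: continuous_arcsin_pq.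
exact: arcsin_pqK.
Qed.

Lemma is_derive_sin_pq (y : R) : 0 < y < pi_pq p q / 2 ->
  is_derive y 1 sin ((1 - sin y `^ q) `^ p^-1).
Proof.
move=> yI; have /andP[y0 y1] := yI; have xI := sin_pq_itvoo yI.
have eK : arcsin (sin y) = y by rewrite sin_pqK// !ltW.
have := @is_derive_inverse R arcsin sin (h (sin y)) (sin y).
rewrite eK invrK; apply.
- near=> t; apply: arcsin_pqK; apply: subset_itv_oo_cc; near: t.
  exact: near_in_itvoo.
- near=> t; apply: differentiable_continuous; apply/derivable1_diffP.
  apply: ex_derive; apply: is_derive_arcsin_pq; near: t.
  exact: near_in_itvoo.
- exact: is_derive_arcsin_pq.
- rewrite gt_eqF// invr_gt0 powR_gt0// subr_gt0.
  by have /andP[] := powR_itvoo q_gt0 xI.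
Unshelve. all: by end_near. Qed.

(** The inverse function rule already yields, inside the interval, the power that the definition
    prescribes elsewhere. One formula thus replaces the case split in all later computations. *)
Lemma cos_pqE (y : R) : cos_pq p q y = (1 - sin y `^ q) `^ p^-1.
Proof.
rewrite /cos_pq; case: ifP => // yI.
by rewrite derive1E; apply: derive_val; exact: is_derive_sin_pq.
Qed.

End arcsin_pq.

(** * Continuity and differentiation tools, then the explicit half wave and its equation *)

Section half_wave.
Context {R : realType}.

(** The absolute value gives a function continuous on the whole line, including 0, that agrees with
    the power on nonnegative bases. It handles the endpoints, where such bases vanish. *)
Lemma continuous_normr_powR (a : R) : 0 < a -> continuous (fun x : R => `|x| `^ a).
Proof.
move=> a0 x; have [->|xn0] := eqVneq x 0.
  rewrite /continuous_at normr0 powR0 ?gt_eqF//.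
  apply/cvgrPdist_lt => /= e e0; near=> t.
  rewrite sub0r normrN ger0_norm ?powR_ge0//.
  have -> : e = (e `^ a^-1) `^ a by rewrite -powRrM mulVf ?powRr1 ?gt_eqF ?ltW.
  apply: gt0_ltr_powR => //; rewrite ?nnegrE ?powR_ge0//.
  near: t; exists (e `^ a^-1) => /=; first by rewrite powR_gt0.
  by move=> t; rewrite /ball_ /= sub0r normrN.
apply: (@continuous_comp _ _ _ (fun x : R => `|x|) (fun y => y `^ a)).
  exact: norm_continuous.
apply: differentiable_continuous; apply/derivable1_diffP.
by apply: derivable_powR; rewrite in_itv/= andbT normr_gt0.
Unshelve. all: by end_near. Qed.

(** The outer function may be continuous only relative to [B], as is [sin_pq] on its segment; points
    near [x] in [A] are sent into [B], where that continuity can be used. *)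
Lemma within_continuous_comp_within (A B : set R) (f g : R -> R) :
  {within A, continuous f} -> {within B, continuous g} ->
  (forall x, A x -> B (f x)) -> {within A, continuous (g \o f)}.
Proof.
move=> /subspace_continuousP cf /subspace_continuousP cg AB.
apply/subspace_continuousP => x Ax.
apply: (@cvg_comp _ _ _ f g _ _ _ _ (cg _ (AB _ Ax))) => P hP.
have h : \forall t \near x, A t -> B (f t) -> P (f t) by exact: (cf x Ax _ hP).
suff : \forall t \near x, A t -> P (f t) by [].
by apply: filterS h => t h At; exact: h At (AB _ At).
Qed.

(** This is the half wave as a function of the sine, up to scaling. Absolute values around both
    bases change nothing on the unit interval and make continuity global. *)
Lemma continuous_half_wave_profile (r : R) : 1 < r ->
  {within `[0, 1], continuous (fun s : R => (1 - s `^ r) `^ ((r - 1) / r) * s)}.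
Proof.
move=> r1; have r0 : 0 < r by exact: lt_trans r1.
pose G (s : R) := `|1 - `|s| `^ r| `^ ((r - 1) / r) * s.
pose G0 (s : R) := (1 - s `^ r) `^ ((r - 1) / r) * s.
apply: (@subspace_eq_continuous _ `[(0 : R), 1]%classic _ G G0).
  move=> s; rewrite /G /G0 inE/= in_itv/= => s01; have /andP[s0 s1] := s01.
  have /andP[_ sr1] := powR_itvcc r0 s01.
  by rewrite (ger0_norm s0) ger0_norm// subr_ge0.
apply: continuous_subspaceT => s; apply: cvgM; last exact: cvg_id.
apply: (@continuous_comp _ _ _ (fun s : R => 1 - `|s| `^ r)
  (fun u : R => `|u| `^ ((r - 1) / r))).
  by apply: cvgB; [exact: cvg_cst|exact: continuous_normr_powR].
by apply: continuous_normr_powR; rewrite divr_gt0// subr_gt0.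
Qed.

Lemma is_derive_itv_continuous (f df : R -> R) (a b : R) :
  {in `]a, b[, forall x : R, is_derive x 1 f (df x)} -> {in `]a, b[, continuous f}.
Proof.
move=> fdf x xI; apply: differentiable_continuous; apply/derivable1_diffP.
by apply: ex_derive; exact: fdf.
Qed.

Lemma eq_itv_is_derive (f g : R -> R) (a b x d : R) :
  {in `]a, b[, f =1 g} -> x \in `]a, b[ -> is_derive x 1 f d -> is_derive x 1 g d.
Proof.
move=> fg xI; apply: near_eq_is_derive; near=> t; apply: fg; near: t.
exact: near_in_itvoo.
Unshelve. all: by end_near. Qed.

(** Differentiation is local, so agreement with [f1] on the open interval is enough to differentiate
    the first derivative of [f] there. *)
Lemma C0_C2_is_derive (H : R) (f f1 f2 : R -> R) :
  {within `[0, H], continuous f} ->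
  {in `]0, H[, forall x : R, is_derive x 1 f (f1 x)} ->
  {in `]0, H[, forall x : R, is_derive x 1 f1 (f2 x)} ->
  {in `]0, H[, continuous f2} ->
  [/\ C0_C2 H f, {in `]0, H[, f^`()%classic =1 f1} &
      {in `]0, H[, f^`(2)%classic =1 f2}].
Proof.
move=> cf df1 df2 cf2.
have e1 : {in `]0, H[, f1 =1 f^`()%classic}.
  move=> x xI; rewrite derive1E.
  by rewrite (@derive_val _ _ _ _ _ _ _ (df1 x xI)).
have d2 : {in `]0, H[, forall x : R, is_derive x 1 f^`()%classic (f2 x)}.
  by move=> x xI; exact: (eq_itv_is_derive e1 xI (df2 x xI)).
have e2 : {in `]0, H[, f2 =1 f^`(2)%classic}.
  move=> x xI; rewrite derive1nS derive1n1 derive1E.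
  by rewrite (@derive_val _ _ _ _ _ _ _ (d2 x xI)).
split; [split|by move=> x /e1|by move=> x /e2] => //.
- by move=> x xI; apply: ex_derive; exact: df1.
- by move=> x xI; apply: ex_derive; exact: d2.
- move=> x xI; have := cf2 x xI; rewrite /continuous_at -(e2 x xI).
  apply: cvg_trans; apply: near_eq_cvg; near=> t; apply: e2; near: t.
  exact: near_in_itvoo.
Unshelve. all: by end_near. Qed.

Lemma C0_C2_derive (H : R) (f : R -> R) : C0_C2 H f ->
  {in `]0, H[, forall x : R, is_derive x 1 f (f^`()%classic x)} /\
  {in `]0, H[, forall x : R, is_derive x 1 f^`()%classic (f^`(2)%classic x)}.
Proof.
move=> [_ d1 d2 _]; split=> x xI.
  by rewrite derive1E; apply/derivableP; exact: d1.
by rewrite derive1nS derive1n1 derive1E; apply/derivableP; exact: d2.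
Qed.

(** [u_of H m] unfolds to [half_wave (r_of m) H]: the parameter [m] enters only through [r], so the
    analysis is done for any [r > 1]. *)
Definition half_wave (r H x : R) : R :=
  let k := pi_pq r r / (2 * H) in
  2 * H / (r * pi_pq r r) * cos_pq r r (k * x) `^ (r - 1) * sin_pq r r (k * x).

Variables (r H : R).
Hypotheses (r_gt1 : 1 < r) (H_gt0 : 0 < H).
Let k := pi_pq r r / (2 * H).
Local Notation S x := (sin_pq r r (k * x)).

Let r_gt0 : 0 < r. Proof. exact: lt_trans r_gt1. Qed.
Let pi_gt0 : 0 < pi_pq r r. Proof. exact: pi_pq_gt0. Qed.
Let k_gt0 : 0 < k. Proof. by rewrite divr_gt0// mulr_gt0. Qed.
Let kH : k * H = pi_pq r r / 2.
Proof. by rewrite /k; field; rewrite gt_eqF. Qed.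

Let k_itvcc (x : R) : 0 <= x <= H -> 0 <= k * x <= pi_pq r r / 2.
Proof.
by move=> /andP[x0 xH]; rewrite mulr_ge0 ?(ltW k_gt0)//= -kH ler_pM2l.
Qed.

Let k_itvoo (x : R) : 0 < x < H -> 0 < k * x < pi_pq r r / 2.
Proof.
by move=> /andP[x0 xH]; rewrite mulr_gt0//= -kH ltr_pM2l.
Qed.

Lemma half_waveE (x : R) :
  half_wave r H x = (r * k)^-1 * ((1 - S x `^ r) `^ ((r - 1) / r) * S x).
Proof.
rewrite /half_wave -/k cos_pqE// -powRrM [r^-1 * _]mulrC [RHS]mulrA.
congr (_ * _ * _).
by rewrite /k; field; rewrite !gt_eqF.
Qed.

Let sin_itvcc (x : R) : 0 <= x <= H -> 0 <= S x <= 1.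
Proof. by move=> /k_itvcc; exact: sin_pq_itvcc. Qed.

Let sin_itvoo (x : R) : 0 < x < H -> 0 < S x < 1.
Proof. by move=> /k_itvoo; exact: sin_pq_itvoo. Qed.

Lemma within_continuous_scaled_sin_pq :
  {within `[0, H], continuous (fun x => S x)}.
Proof.
apply: (@within_continuous_comp_within _ _ (fun x => k * x) _ _
  (continuous_sin_pq r_gt1 r_gt1)).
  by apply: continuous_subspaceT => x; exact: mulrl_continuous.
by move=> x; rewrite /= !in_itv/=; exact: k_itvcc.
Qed.

Lemma is_derive_scaled_sin_pq (x : R) : 0 < x < H ->
  is_derive x 1 (fun x => S x) (k * (1 - S x `^ r) `^ r^-1).
Proof.
move=> xI; have d := is_derive_sin_pq r_gt1 r_gt1 (k_itvoo xI).
have dk : is_derive x 1 (fun x : R => k * x) k.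
  by apply: is_derive_eq; rewrite /GRing.scale/= !mulr1 ?addr0.
have := @is_derive1_comp R _ _ x _ _ d dk.
by rewrite mulrC.
Qed.

Lemma half_wave_continuous : {within `[0, H], continuous (half_wave r H)}.
Proof.
rewrite (_ : half_wave r H = (fun s => (r * k)^-1 * s) \o
    ((fun s => (1 - s `^ r) `^ ((r - 1) / r) * s) \o (fun x => S x))); last first.
  by apply/funext => x; rewrite half_waveE.
apply: within_continuous_comp; first by move=> y _; exact: mulrl_continuous.
apply: (within_continuous_comp_within within_continuous_scaled_sin_pq
  (continuous_half_wave_profile r_gt1)).
by move=> x; rewrite /= !in_itv/=; exact: sin_itvcc.
Qed.

(** After differentiation the exponents of [1 - S ^ r] add up to 1 in one term and to 0 in the
    other. All fractional powers disappear, and the slope is affine in [S ^ r]. *)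
Lemma is_derive_half_wave (x : R) : 0 < x < H ->
  is_derive x 1 (half_wave r H) (r^-1 - S x `^ r).
Proof.
move=> xI; have s01 := sin_itvoo xI; have /andP[s0 s1] := s01.
have /andP[sr0 sr1] := powR_itvoo r_gt0 s01.
have v0 : 0 < 1 - S x `^ r by rewrite subr_gt0.
have dS := is_derive_scaled_sin_pq xI.
have dSr := @is_derive1_comp R (fun y => y `^ r) _ x _ _ (is_derive1_powR r s0) dS.
have dV : is_derive x 1 (fun x => 1 - S x `^ r)
    (0 - r * S x `^ (r - 1) * (k * (1 - S x `^ r) `^ r^-1)).
  exact: is_deriveB.
have dP := @is_derive1_comp R (fun y => y `^ ((r - 1) / r)) _ x _ _
  (is_derive1_powR ((r - 1) / r) v0) dV.
have := is_deriveZ (r * k)^-1 (is_deriveM dP dS).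
rewrite (_ : _ \*: _ = half_wave r H); last first.
  by apply/funext => t; rewrite /= half_waveE.
move=> [dh eh]; apply: DeriveDef => //; rewrite eh /GRing.scale/=.
set s := S x; set v := 1 - s `^ r.
have vn0 : v != 0 by rewrite gt_eqF.
have e1 : v `^ ((r - 1) / r) * v `^ r^-1 = v.
  rewrite -powRD; last by rewrite vn0 implybT.
  rewrite (_ : _ + _ = 1); first by rewrite powRr1// ltW.
  by field; rewrite gt_eqF.
have e2 : v `^ ((r - 1) / r - 1) * v `^ r^-1 = 1.
  rewrite -powRD; last by rewrite vn0 implybT.
  rewrite (_ : _ + _ = 0); first by rewrite powRr0.
  by field; rewrite gt_eqF.
have e3 : s * s `^ (r - 1) = s `^ r by rewrite mulr_powRB1// ltW.
transitivity ((r * k)^-1 * (k * (v `^ ((r - 1) / r) * v `^ r^-1)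
  - (r - 1) * k * (s * s `^ (r - 1)) * (v `^ ((r - 1) / r - 1) * v `^ r^-1))).
  by field; rewrite !gt_eqF.
rewrite e1 e2 e3 /v; field; by rewrite !gt_eqF.
Qed.

Lemma is_derive_half_wave_slope (x : R) : 0 < x < H ->
  is_derive x 1 (fun x => r^-1 - S x `^ r)
    (- (r * k * S x `^ (r - 1) * (1 - S x `^ r) `^ r^-1)).
Proof.
move=> xI; have s01 := sin_itvoo xI; have /andP[s0 s1] := s01.
have dS := is_derive_scaled_sin_pq xI.
have dSr := @is_derive1_comp R (fun y => y `^ r) _ x _ _ (is_derive1_powR r s0) dS.
have := @is_deriveB R R R (cst r^-1) _ x 1 _ _ (is_derive_cst _ _ _) dSr.
by move=> [dh eh]; apply: DeriveDef => //; rewrite eh; ring.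
Qed.

(** The slope formula extends continuously to the endpoints, which allows its square to be
    integrated by the fundamental theorem of calculus. *)
Lemma within_continuous_half_wave_slope :
  {within `[0, H], continuous (fun x => r^-1 - S x `^ r)}.
Proof.
pose V (s : R) := r^-1 - `|s| `^ r.
apply: (@subspace_eq_continuous _ `[0, H]%classic _ (V \o (fun x => S x))).
  move=> x; rewrite inE/= in_itv/= => /sin_itvcc/andP[s0 _].
  by rewrite /V/= ger0_norm.
apply: within_continuous_comp within_continuous_scaled_sin_pq => s _.
by apply: cvgB; [exact: cvg_cst|exact: continuous_normr_powR].
Qed.

Lemma half_wave_gt0 (x : R) : 0 < x < H -> 0 < half_wave r H x.
Proof.
move=> xI; have s01 := sin_itvoo xI; have /andP[s0 s1] := s01.
have /andP[sr0 sr1] := powR_itvoo r_gt0 s01.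
rewrite half_waveE; apply: mulr_gt0; first by rewrite invr_gt0 mulr_gt0.
by rewrite mulr_gt0// powR_gt0// subr_gt0.
Qed.

Lemma half_wave0 : half_wave r H 0 = 0.
Proof. by rewrite half_waveE mulr0 sin_pq0// !mulr0. Qed.

Lemma half_waveH : half_wave r H H = 0.
Proof.
rewrite half_waveE kH sin_pq_half// powR1 subrr powR0 ?mul0r ?mulr0//.
by rewrite gt_eqF// divr_gt0// subr_gt0.
Qed.

(** The roots [c / r] and [c / r - c] are the limiting slopes of [c * half_wave r H] at 0 and at
    [H], where [S] equals 0 and 1. *)
Definition slope_equation (c : R) (f : R -> R) : Prop :=
  {in `]0, H[, forall x, f x * f^`(2)%classic x =
     (f^`()%classic x - c / r) * (f^`()%classic x - (c / r - c))}.

(** The two factors of the equation are [- c S ^ r] and [c (1 - S ^ r)]; in the product of [f] and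
    its second derivative the fractional powers recombine to exactly these. *)
Lemma half_wave_solution (c : R) (f : R -> R) : 0 < c ->
  {in `[0, H], forall x, f x = c * half_wave r H x} ->
  [/\ positive_dirichlet H f,
      {in `]0, H[, forall x, f^`()%classic x = c * (r^-1 - S x `^ r)} &
      slope_equation c f].
Proof.
move=> c0 fE.
pose f1 x := c * (r^-1 - S x `^ r).
pose f2 x := c * - (r * k * S x `^ (r - 1) * (1 - S x `^ r) `^ r^-1).
have foo : {in `]0, H[, (fun x => c * half_wave r H x) =1 f}.
  by move=> x xI; rewrite fE//; exact: subset_itv_oo_cc.
have cf : {within `[0, H], continuous f}.
  apply: (@subspace_eq_continuous _ `[0, H]%classic _ (fun x => c * half_wave r H x)).
    by move=> x; rewrite inE/= => /fE.
  move=> x; apply: cvgM; [exact: cvg_cst|exact: half_wave_continuous].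
have d1 : {in `]0, H[, forall x : R, is_derive x 1 f (f1 x)}.
  move=> x xI; apply: (eq_itv_is_derive foo xI).
  exact: is_deriveZ (is_derive_half_wave xI).
have d2 : {in `]0, H[, forall x : R, is_derive x 1 f1 (f2 x)}.
  move=> x xI; exact: is_deriveZ (is_derive_half_wave_slope xI).
have f0 : {in `]0, H[, forall x, 0 < f x}.
  by move=> x xI; rewrite -foo// mulr_gt0// half_wave_gt0.
have ode : {in `]0, H[, forall x, f x * f2 x = (f1 x - c / r) * (f1 x - (c / r - c))}.
  move=> x xI; rewrite -foo// half_waveE /f1 /f2.
  have s01 := sin_itvoo xI; have /andP[s0 s1] := s01.
  have /andP[sr0 sr1] := powR_itvoo r_gt0 s01.
  set s := S x in s01 s0 s1 sr0 sr1 *; set v := 1 - s `^ r.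
  have v0 : 0 < v by rewrite subr_gt0.
  have vn0 : v != 0 by rewrite gt_eqF.
  have e1 : v `^ ((r - 1) / r) * v `^ r^-1 = v.
    rewrite -powRD; last by rewrite vn0 implybT.
    rewrite (_ : _ + _ = 1); first by rewrite powRr1// ltW.
    by field; rewrite gt_eqF.
  have e3 : s * s `^ (r - 1) = s `^ r by rewrite mulr_powRB1// ltW.
  transitivity (- c ^+ 2 * (v `^ ((r - 1) / r) * v `^ r^-1) * (s * s `^ (r - 1))).
    by field; rewrite !gt_eqF.
  by rewrite e1 e3 /v; field; rewrite gt_eqF.
have cf2 : {in `]0, H[, continuous f2}.
  (* Continuity of the second derivative is read off the equation, as a quotient of continuous
     functions by the positive [f]. *)
  pose g2 x := (f1 x - c / r) * (f1 x - (c / r - c)) / f x.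
  have c1 := is_derive_itv_continuous d2; have c2 := is_derive_itv_continuous d1.
  have e : {in `]0, H[, g2 =1 f2}.
    by move=> x xI; rewrite /g2 -ode// mulrAC divff ?mul1r// gt_eqF// f0.
  have cg (x : R) : x \in `]0, H[ -> {for x, continuous g2}.
    move=> xI; apply: (@continuousM _ _ (fun t => (f1 t - c / r) * (f1 t - (c / r - c)))
      (fun t => (f t)^-1)); last by apply: continuousV; [rewrite gt_eqF// f0|exact: c2].
    by apply: continuousM; (apply: continuousB; [exact: c1|exact: cst_continuous]).
  move=> x xI; have := cg x xI; rewrite /continuous_at /prop_for e//.
  apply: cvg_trans; apply: near_eq_cvg; near=> t; apply: e; near: t.
  exact: near_in_itvoo.
have [C2 E1 E2] := C0_C2_is_derive cf d1 d2 cf2.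
split; [split=> //|exact: E1|].
- by rewrite fE ?half_wave0 ?mulr0// in_itv/= lexx ltW.
- by rewrite fE ?half_waveH ?mulr0// in_itv/= lexx ltW.
- by move=> x xI; rewrite E1// E2// ode.
Unshelve. all: by end_near. Qed.

End half_wave.

(** * Constancy and sign preservation for first-order linear equations *)

Section linear_ode.
Context {R : realType}.
Local Notation mu := (@lebesgue_measure R).

Lemma is_derive0_itv_cst (f : R -> R) (a b x y : R) :
  {in `]a, b[, forall x : R, is_derive x 1 f 0} ->
  x \in `]a, b[ -> y \in `]a, b[ -> f x = f y.
Proof.
move=> df; wlog xy : x y / x <= y.
  by move=> W xI yI; have [/W->//|/ltW/W->//] := leP x y.
rewrite !in_itv/= => /andP[ax _] /andP[_ yb].
have sub (z : R) : z \in `[x, y] -> z \in `]a, b[.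
  rewrite !in_itv/= => /andP[xz zy].
  by rewrite (lt_le_trans ax)// (le_lt_trans zy).
have [||z _] := @MVT_segment R f (fun=> 0) x y xy.
- by move=> z zxy; apply: df; apply: sub; exact: subset_itv_oo_cc.
- apply: continuous_in_subspaceT => z; rewrite inE/= => /sub zI.
  exact: is_derive_itv_continuous df _ zI.
by rewrite mul0r => /eqP; rewrite subr_eq0 => /eqP.
Qed.

(** With [P] a primitive of [g], the product [w exp (- P)] is constant, so [e = exp (P x - P y)].
    Hence [w] keeps one sign, or vanishes identically. *)
Lemma linear_ode_sign (w g : R -> R) (a b x y : R) :
  {in `]a, b[, forall x : R, is_derive x 1 w (w x * g x)} ->
  {in `]a, b[, continuous g} -> x \in `]a, b[ -> y \in `]a, b[ ->
  exists2 e, 0 < e & w x = e * w y.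
Proof.
move=> dw cg; rewrite !in_itv/= => /andP[ax xb] /andP[ay yb].
(* The segment [[d, e]] is compact inside []a, b[], so [g] is integrable on it, and contains [x] and
   [y] in its interior, so [P] is differentiable at both. *)
pose d := (a + Num.min x y) / 2; pose e := (b + Num.max x y) / 2.
have [am mx my] : [/\ a < Num.min x y, Num.min x y <= x & Num.min x y <= y].
  by rewrite lt_min ax ay !ge_min !lexx orbT.
have [bM Mx My] : [/\ Num.max x y < b, x <= Num.max x y & y <= Num.max x y].
  by rewrite gt_max xb yb !le_max !lexx orbT.
have [ad dx dy] : [/\ a < d, d < x & d < y] by rewrite /d; split; lra.
have [eb xe ye] : [/\ e < b, x < e & y < e] by rewrite /e; split; lra.
have sub (z : R) : z \in `[d, e] -> z \in `]a, b[.
  rewrite !in_itv/= => /andP[dz ze].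
  by rewrite (lt_le_trans ad)// (le_lt_trans ze).
have ig : mu.-integrable `[d, e] (EFin \o g).
  apply: continuous_compact_integrable; first exact: segment_compact.
  by apply: continuous_in_subspaceT => z; rewrite inE/= => /sub; exact: cg.
pose P (t : R) := (\int[mu]_(s in `[d, t]) g s)%R.
have dP : {in `]d, e[, forall z : R, is_derive z 1 P (g z)}.
  move=> z zI; have := zI; rewrite in_itv/= => /andP[dz ze].
  have [|dd ee] := continuous_FTC1_closed ze ig dz.
    by apply: cg; apply: sub; exact: subset_itv_oo_cc.
  by apply: DeriveDef; [exact: dd|rewrite -derive1E; exact: ee].
have xI : x \in `]d, e[ by rewrite in_itv/= dx xe.
have yI : y \in `]d, e[ by rewrite in_itv/= dy ye.
have dE : {in `]d, e[, forall z : R, is_derive z 1 (fun t => w t * expR (- P t)) 0}.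
  move=> z zI; have dNP := is_deriveN (dP z zI).
  have dX := @is_derive1_comp R expR (- P) z _ _ (is_derive_expR _) dNP.
  have := is_deriveM (dw z (sub z (subset_itv_oo_cc zI))) dX.
  by move=> [h1 h2]; apply: DeriveDef => //; rewrite h2 /GRing.scale/=; ring.
have := is_derive0_itv_cst dE xI yI => E.
exists (expR (P x - P y)); first exact: expR_gt0.
rewrite expRD expRN [LHS](_ : _ = w x * expR (- P x) * expR (P x)); last first.
  by rewrite -mulrA -expRD addNr expR0 mulr1.
by rewrite E expRN; ring.
Qed.

End linear_ode.

(** * Uniqueness of the positive solution of the slope equation *)

Section half_wave_uniqueness.
Context {R : realType}.

(** Endpoint values are one-sided limits. This carries the boundary conditions over to a formula
    known only in the interior. *)
Lemma within_continuous_eq_itvcc (f g : R -> R) (a b : R) : a < b ->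
  {within `[a, b], continuous f} -> {within `[a, b], continuous g} ->
  {in `]a, b[, f =1 g} -> f a = g a /\ f b = g b.
Proof.
move=> ab /(continuous_within_itvP _ ab)[_ fa fb].
move=> /(continuous_within_itvP _ ab)[_ ga gb] fg; split.
- apply: (@cvg_unique _ (@norm_hausdorff R R) (f @ a^'+)) => //.
  apply: cvg_trans ga; apply: near_eq_cvg; near=> t; rewrite fg// in_itv/=.
  by apply/andP; split; near: t; [exact: nbhs_right_gt|exact: nbhs_right_lt].
- apply: (@cvg_unique _ (@norm_hausdorff R R) (f @ b^'-)) => //.
  apply: cvg_trans gb; apply: near_eq_cvg; near=> t; rewrite fg// in_itv/=.
  by apply/andP; split; near: t; [exact: nbhs_left_gt|exact: nbhs_left_lt].
Unshelve. all: by end_near. Qed.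

Lemma affine_itvoo_bounds (d e H M : R) : 0 < H ->
  {in `]0, H[, forall x, 0 < d * x + e < M} -> 0 <= e /\ d * H + e <= M.
Proof.
move=> H0 h.
have c : {within `[0, H], continuous (fun x : R => d * x + e)}.
  apply: continuous_subspaceT => x; apply: cvgD; last exact: cvg_cst.
  exact: mulrl_continuous.
have /(continuous_within_itvP _ H0)[_ c0 cH] := c.
split.
- suff : 0 <= d * 0 + e by rewrite mulr0 add0r.
  apply: (cvgr_to_ge c0); near=> t.
  have tI : t \in `]0, H[.
    by rewrite in_itv/=; apply/andP; split; near: t;
      [exact: nbhs_right_gt|exact: nbhs_right_lt].
  by have /andP[/ltW] := h t tI.
- apply: (cvgr_to_le cH); near=> t.
  have tI : t \in `]0, H[.
    by rewrite in_itv/=; apply/andP; split; near: t;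
      [exact: nbhs_left_gt|exact: nbhs_left_lt].
  by have /andP[_ /ltW] := h t tI.
Unshelve. all: by end_near. Qed.

(** The substitution [s = (1 / r - f' / c) ^ (1 / r)] inverts the slope formula
    [f' = c (1 / r - S ^ r)] of the half wave, so [s] has to turn out to be the generalized sine. *)
Lemma half_wave_unique (r H c : R) (f : R -> R) : 1 < r -> 0 < H -> 0 < c ->
  positive_dirichlet H f -> slope_equation r H c f ->
  {in `[0, H], forall x, f x = c * half_wave r H x}.
Proof.
move=> r1 H0 c0 [C2 fpos fa fb] ode.
have r0 : 0 < r by exact: lt_trans r1.
have [d1 d2] := C0_C2_derive C2.
have [cf _ _ _] := C2.
have cf1 := is_derive_itv_continuous d2; have cfo := is_derive_itv_continuous d1.
(* The critical point given by Rolle's theorem is the base point: the slope 0 lies strictly between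
   the roots, since [c / r - c < 0 < c / r]. *)
have [z zI z0] : exists2 z, z \in `]0, H[ & f^`()%classic z = 0.
  have [|z zI dz] := Rolle H0 _ cf (etrans fa (esym fb)).
    by move=> x xI; apply: ex_derive; exact: d1.
  by exists z => //; rewrite derive1E; exact: (@derive_val _ _ _ _ _ _ _ dz).
set f' := f^`()%classic in d1 d2 cf1 z0 *.
set f'' := f^`(2)%classic in d2 *.
have {}ode : {in `]0, H[, forall x,
    f x * f'' x = (f' x - c / r) * (f' x - (c / r - c))} by exact: ode.
(* With [n] the other root, [w = f' - m] solves [w' = w (f' - n) / f], so it has everywhere the sign
   of its value [- m] at [z]. The two orders of the roots give the two bounds. *)
have sign (m n : R) : {in `]0, H[, forall x, f x * f'' x = (f' x - m) * (f' x - n)} ->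
    {in `]0, H[, forall x, exists2 e, 0 < e & f' x - m = e * - m}.
  move=> E x xI.
  have dw : {in `]0, H[, forall x : R, is_derive x 1 (fun t => f' t - m)
      ((f' x - m) * ((f' x - n) / f x))}.
    move=> t tI; rewrite mulrA -E// mulrAC divff ?gt_eqF ?fpos// mul1r -[f'' t]subr0.
    exact: is_deriveB (d2 t tI) (is_derive_cst _ _ _).
  have cg : {in `]0, H[, continuous (fun x : R => (f' x - n) / f x)}.
    move=> t tI; apply: (@continuousM _ _ (fun t => f' t - n) (fun t => (f t)^-1)).
      by apply: continuousB; [exact: cf1|exact: cst_continuous].
    by apply: continuousV; [rewrite gt_eqF// fpos|exact: cfo].
  by have [e e0 ->] := linear_ode_sign dw cg xI zI; exists e; rewrite // z0 sub0r.
have lt1 : {in `]0, H[, forall x, f' x < c / r}.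
  move=> x xI; have [e e0] := sign _ _ ode x xI.
  by rewrite mulrN => E; rewrite -subr_lt0 E oppr_lt0 mulr_gt0// divr_gt0.
have lt2 : {in `]0, H[, forall x, c / r - c < f' x}.
  have ode' : {in `]0, H[, forall x, f x * f'' x = (f' x - (c / r - c)) * (f' x - c / r)}.
    by move=> x xI; rewrite ode// mulrC.
  move=> x xI; have [e e0] := sign _ _ ode' x xI.
  move=> E; rewrite -subr_gt0 E mulr_gt0// oppr_gt0 subr_lt0 ltr_pdivrMr//.
  by rewrite ltr_pMr.
pose v t := r^-1 - f' t / c.
have v01 : {in `]0, H[, forall x, 0 < v x < 1}.
  move=> x xI; rewrite /v.
  have -> : r^-1 - f' x / c = (c / r - f' x) / c by field; rewrite !gt_eqF.
  rewrite divr_gt0 ?subr_gt0 ?lt1//= ltr_pdivrMr// mul1r.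
  by have := lt2 x xI; lra.
(* The factors of the slope equation are [- c v] and [c (1 - v)], so [v] follows a logistic equation
   with rate [c / f]. *)
have dv : {in `]0, H[, forall x : R, is_derive x 1 v (c * v x * (1 - v x) / f x)}.
  move=> x xI.
  have -> : c * v x * (1 - v x) / f x = - (c^-1 * f'' x).
    have -> : f'' x = (f' x - c / r) * (f' x - (c / r - c)) / f x.
      by rewrite -ode// mulrAC divff ?mul1r// gt_eqF// fpos.
    by rewrite /v; field; rewrite !gt_eqF// fpos.
  have := is_deriveB (is_derive_cst r^-1 x 1) (is_deriveZ c^-1 (d2 x xI)).
  rewrite (_ : _ - _ = v); last first.
    by apply/funext => t; rewrite /v/= [_ / c]mulrC.
  by rewrite sub0r.
pose b := (r - 1) / r.
have b0 : 0 < b by rewrite divr_gt0// subr_gt0.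
have s_r (x : R) : x \in `]0, H[ -> (v x `^ r^-1) `^ r = v x.
  move=> /v01/andP[v0 _].
  by rewrite -powRrM mulVf ?gt_eqF// powRr1// ltW.
have s01 (x : R) : x \in `]0, H[ -> 0 < v x `^ r^-1 < 1.
  by move=> /v01; apply: powR_itvoo; rewrite invr_gt0.
have dvp (x : R) : x \in `]0, H[ ->
    is_derive x 1 (fun t => v t `^ r^-1)
      (c / r * (v x `^ r^-1) * (1 - v x) / f x).
  move=> xI; have /andP[v0 v1] := v01 x xI.
  have := @is_derive1_comp R (fun y => y `^ r^-1) v x _ _
    (is_derive1_powR r^-1 v0) (dv x xI).
  move=> [h1 h2]; apply: DeriveDef => //; rewrite h2.
  have e : v x `^ r^-1 = v x * v x `^ (r^-1 - 1).
    by rewrite mulr_powRB1// ?invr_gt0// ltW.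
  by rewrite e; field; rewrite !gt_eqF// fpos.
have dwp (x : R) : x \in `]0, H[ ->
    is_derive x 1 (fun t => (1 - v t) `^ b)
      (- (b * c * (1 - v x) `^ b * v x / f x)).
  move=> xI; have /andP[v0 v1] := v01 x xI.
  have u0 : 0 < 1 - v x by rewrite subr_gt0.
  have du := is_deriveB (is_derive_cst (1 : R) x 1) (dv x xI).
  have := @is_derive1_comp R (fun y => y `^ b) (fun t => 1 - v t) x _ _
    (is_derive1_powR b u0) du.
  move=> [h1 h2]; apply: DeriveDef => //; rewrite h2.
  have e : (1 - v x) `^ b = (1 - v x) * (1 - v x) `^ (b - 1).
    by rewrite mulr_powRB1// ltW.
  by rewrite e; field; rewrite gt_eqF// fpos.
(* The first integral: [F / f] is constant along solutions. *)
pose F t := (1 - v t) `^ b * v t `^ r^-1.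
have dFf : {in `]0, H[, forall x : R, is_derive x 1 (fun t => F t / f t) 0}.
  move=> x xI; have fn0 : f x != 0 by rewrite gt_eqF// fpos.
  have := is_deriveM (is_deriveM (dwp x xI) (dvp x xI)) (is_deriveV fn0 (d1 x xI)).
  move=> [h1 h2]; apply: DeriveDef => //; rewrite h2 /GRing.scale/=.
  have -> : f' x = c * (r^-1 - v x) by rewrite /v; field; rewrite !gt_eqF.
  rewrite [X in X * _ + _](_ : _ = (1 - v x) `^ b * v x `^ r^-1)//.
  by rewrite /b; field; rewrite fn0 gt_eqF.
pose K := F z / f z.
have Fpos (x : R) : x \in `]0, H[ -> 0 < F x.
  move=> xI; have /andP[v0 v1] := v01 x xI.
  by rewrite mulr_gt0// powR_gt0// subr_gt0.
have K0 : 0 < K by rewrite divr_gt0 ?Fpos ?fpos.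
have FK (x : R) : x \in `]0, H[ -> f x = K^-1 * F x.
  move=> xI; have E : F x / f x = K := is_derive0_itv_cst dFf xI zI.
  rewrite -E invfM invrK mulrAC mulVf ?mul1r// gt_eqF//; exact: Fpos.
(* The derivative of the arcsine of [s] is [(c / r) F / f], because [1 - v] divided by its power
   [1 / r] leaves the power [b] occurring in [F]; the first integral turns this into the constant
   [d]. *)
pose d := c * K / r.
have d0 : 0 < d by rewrite divr_gt0// mulr_gt0.
have dz : {in `]0, H[, forall x : R,
    is_derive x 1 (fun t => arcsin_pq r r (v t `^ r^-1) - d * t) 0}.
  move=> x xI; have /andP[v0 v1] := v01 x xI.
  have dA := @is_derive1_comp R (arcsin_pq r r) (fun t => v t `^ r^-1) x _ _
    (is_derive_arcsin_pq r1 r1 (s01 x xI)) (dvp x xI).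
  have := is_deriveB dA (is_deriveZ d (is_derive_id x 1)).
  move=> [h1 h2]; apply: DeriveDef => //; rewrite h2 s_r// FK// /F /d /GRing.scale/=.
  have u0 : 0 < 1 - v x by rewrite subr_gt0.
  have un0 : 1 - v x != 0 by rewrite gt_eqF.
  have e : 1 - v x = (1 - v x) `^ b * (1 - v x) `^ r^-1.
    rewrite -powRD ?un0 ?implybT// (_ : b + r^-1 = 1) ?powRr1 ?ltW//.
    by rewrite /b; field; rewrite gt_eqF.
  have n1 : (1 - v x) `^ b != 0 by rewrite gt_eqF// powR_gt0.
  have n2 : (1 - v x) `^ r^-1 != 0 by rewrite gt_eqF// powR_gt0.
  have n3 : v x `^ r^-1 != 0 by rewrite gt_eqF// powR_gt0.
  rewrite [X in _ * X / _](e); field.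
  by rewrite n1 n2 n3 !gt_eqF.
pose e := arcsin_pq r r (v z `^ r^-1) - d * z.
have Ae (x : R) : x \in `]0, H[ -> arcsin_pq r r (v x `^ r^-1) = d * x + e.
  by move=> xI; rewrite /e -(is_derive0_itv_cst dz xI zI) addrC subrK.
have pi0 : 0 < pi_pq r r by exact: pi_pq_gt0.
have affI : {in `]0, H[, forall x, 0 < d * x + e < pi_pq r r / 2}.
  move=> x xI; rewrite -Ae// -(@arcsin_pq0 R r r) -arcsin_pq_half.
  have /andP[s0 s1] := s01 x xI.
  by apply/andP; split; apply: arcsin_pq_lt => //; rewrite in_itv/= ?lexx ?ler01// !ltW.
have [e0 eM] := affine_itvoo_bounds H0 affI.
have sE (x : R) : x \in `]0, H[ -> v x `^ r^-1 = sin_pq r r (d * x + e).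
  move=> xI; rewrite -Ae// arcsin_pqK// in_itv/=.
  by have /andP[s0 s1] := s01 x xI; rewrite !ltW.
pose G (s : R) := (1 - s `^ r) `^ b * s.
pose g (x : R) := K^-1 * G (sin_pq r r (d * x + e)).
have aff (x : R) : 0 <= x <= H -> 0 <= d * x + e <= pi_pq r r / 2.
  move=> /andP[x0 xH]; rewrite (addr_ge0 (mulr_ge0 (ltW d0) x0) e0)/=.
  by apply: le_trans eM; rewrite lerD2r ler_pM2l.
have fg : {in `]0, H[, f =1 g}.
  by move=> x xI; rewrite FK// /F /g /G -sE// s_r.
have cg : {within `[0, H], continuous g}.
  rewrite (_ : g = (fun s => K^-1 * s) \o (G \o (sin_pq r r \o (fun x => d * x + e))))//.
  apply: within_continuous_comp; first by move=> y _; exact: mulrl_continuous.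
  apply: (within_continuous_comp_within _ (continuous_half_wave_profile r1)).
    apply: (within_continuous_comp_within _ (continuous_sin_pq r1 r1)).
      apply: continuous_subspaceT => x; apply: cvgD; last exact: cvg_cst.
      exact: mulrl_continuous.
    by move=> x; rewrite /= !in_itv/=; exact: aff.
  by move=> x; rewrite /= !in_itv/= => /aff; exact: sin_pq_itvcc.
have [g0 gH] := within_continuous_eq_itvcc H0 cf cg fg.
(* The profile vanishes only at the two ends of the segment of [sin_pq], so the boundary conditions
   leave two candidates for each endpoint value of the affine function. *)
have G0 (y : R) : 0 <= y <= pi_pq r r / 2 -> K^-1 * G (sin_pq r r y) = 0 ->
    y = 0 \/ y = pi_pq r r / 2.
  move=> yI /eqP; rewrite mulf_eq0 invr_eq0 gt_eqF//= mulf_eq0.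
  have sK := sin_pqK r1 r1 yI; have /andP[s0 s1] := sin_pq_itvcc r1 r1 yI.
  case/orP => [|/eqP sy0]; last by left; rewrite -sK sy0 arcsin_pq0.
  rewrite powR_eq0 subr_eq0 => /andP[/eqP sy1 _]; right.
  rewrite -sK (_ : sin_pq r r y = 1) ?arcsin_pq_half//.
  by move/eqP: sy1; rewrite eq_sym powR_eq1 ltNge s0 (gt_eqF r0)/= orbF => /eqP.
have dH0 : 0 < d * H by rewrite mulr_gt0.
(* The alternative [e = pi_pq r r / 2] would push [d * H + e] beyond the segment, as [d * H > 0]. *)
have eE : e = 0.
  have : K^-1 * G (sin_pq r r e) = 0 by rewrite -[RHS]fa g0 /g mulr0 add0r.
  have eI : 0 <= e <= pi_pq r r / 2 by rewrite e0 (le_trans _ eM)// lerDr ltW.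
  case/(G0 _ eI) => // E.
  by move: eM; rewrite E gerDr leNgt dH0.
have dE : d * H = pi_pq r r / 2.
  have : K^-1 * G (sin_pq r r (d * H)) = 0 by rewrite -[RHS]fb gH /g eE addr0.
  have eM' : 0 <= d * H <= pi_pq r r / 2 by rewrite ltW//= -[leLHS]addr0 -eE.
  by case/(G0 _ eM') => // E; rewrite E ltxx in dH0.
move=> x; rewrite in_itv/= !le_eqVlt => /andP[/predU1P[<-|x0] /predU1P[->|xH]].
- by rewrite fb half_waveH// mulr0.
- by rewrite fa half_wave0 ?mulr0.
- by rewrite fb half_waveH// mulr0.
(* The frequency fixes the amplitude as well: [d = c K / r] gives [1 / K = c / (r d)]. *)
have dk : d = pi_pq r r / (2 * H).
  by rewrite -[LHS](mulfK (lt0r_neq0 H0)) dE; field; rewrite gt_eqF.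
rewrite fg ?in_itv/= ?x0// /g /G half_waveE// -dk eE addr0 /d /b.
by field; rewrite !gt_eqF.
Qed.

End half_wave_uniqueness.

(** * Energy identity, positivity of the nonlocal term, and reduction of both equations to the slope
    equation *)

Section nonlocal_problem.
Context {R : realType}.
Local Notation mu := (@lebesgue_measure R).

(* The equation gives [(f f' + f + l x)' = f' ^ 2 + f f'' + f' + l = 2 f' ^ 2]. *)
Lemma dirichlet_energy (H l : R) (f V : R -> R) : 0 < H ->
  C0_C2 H f -> f 0 = 0 -> f H = 0 -> {within `[0, H], continuous V} ->
  {in `]0, H[, f^`()%classic =1 V} ->
  {in `]0, H[, forall x, f x * f^`(2)%classic x =
     f^`()%classic x ^+ 2 - f^`()%classic x - l} ->
  (\int[mu]_(t in `]0%R, H[) (f^`()%classic t ^+ 2)%:E = (l * H / 2)%:E)%E.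
Proof.
move=> H0 C2 f0 fH cV fV ode.
have [d1 d2] := C0_C2_derive C2; have [cf _ _ _] := C2.
have cV2 : {within `[0, H], continuous (fun x => V x ^+ 2)}.
  apply: (@within_continuous_comp _ _ _ _ V (fun y : R => y ^+ 2) _ cV) => y _.
  exact: exprn_continuous.
have mV2 : measurable_fun `[0, H] (fun x => V x ^+ 2).
  exact: subspace_continuous_measurable_fun cV2.
(* The extension [V] replaces the derivative so that [F] is continuous up to the endpoints. There
   [f] vanishes, hence only the linear term survives in [F H - F 0]. *)
pose F := 2^-1 \*: (f * V + f + ( *%R l)).
have cF : {within `[0, H], continuous F}.
  move=> x; apply: cvgZr; apply: cvgD; last first.
    by apply: continuous_subspaceT => y; exact: mulrl_continuous.
  by apply: cvgD; [apply: cvgM; [exact: cf|exact: cV]|exact: cf].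
have dF : {in `]0, H[, forall x : R, is_derive x 1 F (V x ^+ 2)}.
  move=> x xI; have dV := eq_itv_is_derive fV xI (d2 x xI).
  have dl : is_derive x 1 ( *%R l) l.
    by apply: is_derive_eq; rewrite /GRing.scale/= mulr1 ?addr0.
  have := is_deriveZ 2^-1
    (is_deriveD (is_deriveD (is_deriveM (d1 x xI) dV) (d1 x xI)) dl).
  move=> [h1 h2]; apply: DeriveDef => //; rewrite h2 /GRing.scale/=.
  by rewrite ode// fV//; field.
have [_ F0 FH] := (continuous_within_itvP _ H0).1 cF.
have E : (\int[mu]_(t in `[0%R, H]) (V t ^+ 2)%:E = (F H)%:E - (F 0)%:E)%E.
  apply: continuous_FTC2 => //.
    by split; [move=> x xI; have [] := dF x xI|exact: F0|exact: FH].
  by move=> x xI; rewrite derive1E; exact: (@derive_val _ _ _ _ _ _ _ (dF x xI)).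
transitivity (\int[mu]_(t in `]0%R, H[) (V t ^+ 2)%:E)%E.
  by apply: eq_integral => x; rewrite inE/= => xI; rewrite fV.
have mV3 : measurable_fun `]0, H[ (fun x => V x ^+ 2).
  by apply: measurable_funS mV2 => //; exact: subset_itv_oo_cc.
rewrite integral_itv_bndo_bndc; last exact/measurable_EFinP.
rewrite integral_itv_obnd_cbnd; last first.
  by apply/measurable_EFinP; apply: measurable_funS mV2 => //; exact: subset_itv_oc_cc.
rewrite E -EFinB; congr EFin.
have -> : F H = 2^-1 * (f H * V H + f H + l * H) by [].
have -> : F 0 = 2^-1 * (f 0 * V 0 + f 0 + l * 0) by [].
by rewrite f0 fH; field.
Qed.

(** If [l = 0], the derivative solves [w' = w (w - 1) / f] and vanishes at a Rolle point, hence
    everywhere. Then [f] is constant, and zero by the boundary condition, against positivity. This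
    makes the square root of [l] an admissible [m]. *)
Lemma nonlocal_coefficient_gt0 (H l : R) (f : R -> R) : 0 < H -> 0 <= l ->
  positive_dirichlet H f ->
  {in `]0, H[, forall x, f x * f^`(2)%classic x =
     f^`()%classic x ^+ 2 - f^`()%classic x - l} -> 0 < l.
Proof.
move=> H0 l0 [C2 fpos f0 fH] ode; rewrite lt_neqAle l0 andbT.
apply/eqP => lE; move: ode; rewrite -lE => ode.
have [d1 d2] := C0_C2_derive C2; have [cf _ _ _] := C2.
have [|z zI dz] := Rolle H0 _ cf (etrans f0 (esym fH)).
  by move=> x xI; apply: ex_derive; exact: d1.
have z0 : f^`()%classic z = 0.
  by rewrite derive1E; exact: (@derive_val _ _ _ _ _ _ _ dz).
have dw : {in `]0, H[, forall x : R, is_derive x 1 f^`()%classic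
    (f^`()%classic x * ((f^`()%classic x - 1) / f x))}.
  move=> x xI; have fn0 : f x != 0 by rewrite gt_eqF ?fpos.
  rewrite (_ : _ * _ = f^`(2)%classic x); first exact: d2.
  by apply: (mulfI fn0); rewrite ode//; field.
have cg : {in `]0, H[, continuous (fun x : R => (f^`()%classic x - 1) / f x)}.
  move=> t tI; apply: (@continuousM _ _ (fun t => f^`()%classic t - 1) (fun t => (f t)^-1)).
    by apply: continuousB; [exact: is_derive_itv_continuous d2 _ tI|exact: cst_continuous].
  apply: continuousV; first by rewrite gt_eqF ?fpos.
  exact: is_derive_itv_continuous d1 _ tI.
have df0 : {in `]0, H[, forall x : R, is_derive x 1 f 0}.
  move=> x xI; have [e _ E] := linear_ode_sign dw cg xI zI.
  by have := d1 x xI; rewrite E z0 mulr0.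
have [] := @within_continuous_eq_itvcc R f (fun=> f z) 0 H H0 cf.
- by apply: continuous_subspaceT => x; exact: cvg_cst.
- by move=> x xI; exact: is_derive0_itv_cst df0 xI zI.
by rewrite f0 => E; have := fpos z zI; rewrite -E ltxx.
Qed.

(** For [m > 0] the square root exceeds [1 / 2], so [1 / r] lies strictly between [1 / 2] and 1. *)
Lemma r_of_itv (m : R) : 0 < m -> 1 < r_of m < 2.
Proof.
move=> m0; set s := Num.sqrt (m ^+ 2 + 1 / 4).
have m2 : 0 < m ^+ 2 by rewrite exprn_gt0.
have s2 : s ^+ 2 = m ^+ 2 + 1 / 4 by rewrite sqr_sqrtr//; lra.
have s0 : 0 <= s by exact: sqrtr_ge0.
have sh : 1 / 2 < s.
  rewrite ltNge; apply/negP => sh.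
  have : s * s <= 1 / 2 * (1 / 2) by rewrite ler_pM.
  by rewrite -expr2 s2; lra.
have i0 : 0 < 1 / (4 * s) by rewrite divr_gt0// mulr_gt0//; lra.
have i1 : 1 / (4 * s) < 1 / 2 by rewrite ltr_pdivrMr; lra.
rewrite /r_of -/s; move: (1 / (4 * s)) i0 i1 => i i0 i1.
have p0 : 0 < 1 / 2 + i by rewrite addr_gt0.
by apply/andP; split; [rewrite invf_gt1|rewrite invf_plt ?posrE]; lra.
Qed.

(** The exponents [p = r / (r - 1)] and [q = r] are conjugate, so [p + q = p q = r ^ 2 / (r - 1)].
    Dividing by this number makes the quadratic in the slope factor with roots [1 / r] and
    [1 / r - 1]. *)
Lemma slope_equation_local (r H : R) (u : R -> R) : 1 < r ->
  {in `]0, H[, forall x,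
    (r / (r - 1) - r) * u^`()%classic x - r / (r - 1) * r * u^`()%classic x ^+ 2
      + (r / (r - 1) + r) * u x * u^`(2)%classic x + 1 = 0} <->
  slope_equation r H 1 u.
Proof.
move=> r1; have rn0 : r != 0 by rewrite gt_eqF// (lt_trans _ r1).
have rn1 : r - 1 != 0 by rewrite subr_eq0 gt_eqF.
have E x : (r / (r - 1) - r) * u^`()%classic x - r / (r - 1) * r * u^`()%classic x ^+ 2
      + (r / (r - 1) + r) * u x * u^`(2)%classic x + 1 =
    r ^+ 2 / (r - 1) * (u x * u^`(2)%classic x -
      (u^`()%classic x - 1 / r) * (u^`()%classic x - (1 / r - 1))).
  by field; rewrite rn0 rn1.
have cn0 : r ^+ 2 / (r - 1) != 0.
  by rewrite mulf_neq0 ?invr_eq0 ?expf_neq0.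
split=> h x xI; have := h x xI.
  by rewrite E => /eqP; rewrite mulf_eq0 (negbTE cn0) subr_eq0 => /eqP.
by rewrite E => ->; rewrite subrr mulr0.
Qed.

(** With [s] the square root, the roots are [1 / 2 + s] and [1 / 2 - s]: their sum is 1 and their
    product is [1 / 4 - s ^ 2 = - m ^ 2]. *)
Lemma slope_equation_nonlocal (m H : R) (f : R -> R) : 0 < m ->
  slope_equation (r_of m) H (2 * Num.sqrt (m ^+ 2 + 1 / 4)) f <->
  {in `]0, H[, forall x, f x * f^`(2)%classic x =
     f^`()%classic x ^+ 2 - f^`()%classic x - m ^+ 2}.
Proof.
move=> m0; rewrite /slope_equation /r_of invrK; set s := Num.sqrt _.
have m2 : 0 < m ^+ 2 by rewrite exprn_gt0.
have s2 : s ^+ 2 = m ^+ 2 + 1 / 4 by rewrite sqr_sqrtr//; lra.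
have sn0 : s != 0 by rewrite gt_eqF// sqrtr_gt0; lra.
have E (y : R) : (y - 2 * s * (1 / 2 + 1 / (4 * s))) *
    (y - (2 * s * (1 / 2 + 1 / (4 * s)) - 2 * s)) = y ^+ 2 - y - m ^+ 2.
  have -> : m ^+ 2 = s ^+ 2 - 1 / 4 by rewrite s2; ring.
  by field.
by split=> h x xI; rewrite h// E.
Qed.

End nonlocal_problem.


Theorem corollary2p2 (R : realType) (H : R) (H_gt0 : 0 < H) :
  (forall phi : R -> R,
     nonlocal_positive_solution H phi <->
     exists2 m : R, 0 < m &
       {in `[0, H], forall x,
          phi x = 2 * Num.sqrt (m ^+ 2 + 1 / 4) * u_of H m x}) /\
  (forall m : R, 0 < m ->
     let r := r_of m in
     1 < r < 2 /\
     (forall u : R -> R,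
        local_positive_solution (r / (r - 1)) r H u <->
        {in `[0, H], forall x, u x = u_of H m x})).
Proof.
split=> [phi|m m0 r]; last first.
  have /andP[r1 r2] := r_of_itv m0; split; first by rewrite r1.
  move=> u; have le := slope_equation_local H u r1.
  split=> [[pd /le se] x xI|uE].
    by rewrite (half_wave_unique r1 H_gt0 ltr01 pd se)// mul1r.
  have [|pd _ se] := @half_wave_solution R r H r1 H_gt0 1 u ltr01.
    by move=> x xI; rewrite mul1r uE.
  by split; [exact: pd|exact/le].
split=> [[pd fin ode]|[m m0 phiE]].
(* Once the integral term is frozen as a number [l], the equation is an ordinary differential
   equation. *)
- set l := (2 / H * _) in ode.
  have ode' : {in `]0, H[, forall x, phi x * phi^`(2)%classic x =
      phi^`()%classic x ^+ 2 - phi^`()%classic x - l}.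
    by move=> x xI; have := ode x xI; rewrite -/l; lra.
  have l0 : 0 <= l.
    apply: mulr_ge0; first by rewrite divr_ge0 ?ltW.
    by apply: Rintegral_ge0 => x _; exact: sqr_ge0.
  have lp := nonlocal_coefficient_gt0 H_gt0 l0 pd ode'.
  have m0 : 0 < Num.sqrt l by rewrite sqrtr_gt0.
  (* This [m] makes [m ^ 2] the value of the integral term. *)
  exists (Num.sqrt l) => //.
  have /andP[r1 r2] := r_of_itv m0.
  apply: (half_wave_unique r1 H_gt0 _ pd).
    by rewrite mulr_gt0// sqrtr_gt0 sqr_sqrtr//; lra.
  by apply/slope_equation_nonlocal => //; rewrite sqr_sqrtr.
- have /andP[r1 r2] := r_of_itv m0.
  set c := 2 * _ in phiE.
  have c0 : 0 < c by rewrite mulr_gt0// sqrtr_gt0 ltr_wpDl ?sqr_ge0//; lra.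
  have [pd dphi /(slope_equation_nonlocal _ _ m0) ode] :=
    half_wave_solution r1 H_gt0 c0 phiE.
  have [C2 _ f0 fH] := pd.
  have cV : {within `[0, H], continuous (fun x => c * ((r_of m)^-1 -
      sin_pq (r_of m) (r_of m) (pi_pq (r_of m) (r_of m) / (2 * H) * x) `^ r_of m))}.
    apply: (@within_continuous_comp _ _ _ _ _ ( *%R c))
      (within_continuous_half_wave_slope r1 H_gt0).
    by move=> y _; exact: mulrl_continuous.
  (* The integral equals [m ^ 2 * H / 2]. This gives finiteness, and the factor [2 / H] in the
     equation returns exactly [m ^ 2]. *)
  have E := dirichlet_energy H_gt0 C2 f0 fH cV dphi ode.
  split; [exact: pd|by rewrite E ltry|] => x xI.
  rewrite /Rintegral E/= ode//; field.
  by rewrite gt_eqF.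
Qed.
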